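(* Let $G$ be any graph with $\operatorname{dom}(G)\ge 2$ and define $$b(G)=\min\bigl\{|N_G(u)\cap N_G(v)| : u,v\in V(G),\ u\ne v,\ uv\notin E(G)\bigr\}.$$ If $H\in\mathcal{IIM}_i(G)$ for any $i\in\mathbb{N}$, then $$\operatorname{dom}(H)\le\operatorname{dom}(G)+b(G)+3.$$
   Context: Graphs are finite, simple, undirected and nonempty. $N(v)=N_G(v)$ is the neighborhood of $v$ in $G$ and $N[v]=\{v\}\cup N(v)$. The Iterated Independent Model (IIM): Given a graph $G'$, one time step adds to $G'$, for every vertex $v \in V(G')$, exactly one new vertex $v'$ (the copy of $v$), which is, by a choice made independently for each $v$, either a clone of $v$, meaning $N(v')=N[v]$, or an anticlone of $v$, meaning $N(v')=V(G')\setminus N[v]$; here $N[v]$ is taken in $G'$, no edges are added among old vertices, and the vertices added in the same step are pairwise non-adjacent. $\mathcal{IIM}_i(G)$ is the set of all graphs obtainable from $G$ by $i$ successive time steps (over all choices), with $\mathcal{IIM}_0(G)=\{G\}$. A dominating set of a graph $G$ is a set $\mathcal{D}\subseteq V(G)$ such that every $v\in V(G)\setminus\mathcal{D}$ is adjacent to some $u\in\mathcal{D}$; $\operatorname{dom}(G)$ is the size of a smallest dominating set. *)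

(* Defs.v *)
From HB Require Import structures.
From mathcomp Require Import all_boot.

Set Implicit Arguments.
Unset Strict Implicit.
Unset Printing Implicit Defensive.

Record sgraph := SGraph {
  vertex :> finType;
  adj : rel vertex;
  adj_sym : symmetric adj;
  adj_irr : irreflexive adj;
  vertex_gt0 : 0 < #|vertex| }.

Section Graph.
Variable G : sgraph.
Implicit Types (u v : G) (D : {set G}).

Definition nbhd v : {set G} := [set u | adj v u].
Definition cnbhd v : {set G} := v |: nbhd v.

Definition dominating D : bool :=
  [forall v, (v \notin D) ==> [exists u in D, adj v u]].

(* [setT] is dominating, so the default value #|G| does not affect the
   minimum; see [dom_attained] and [dom_min]. *)
Definition dom : nat := \big[minn/#|G|]_(D : {set G} | dominating D) #|D|.

Definition nonadj_pair (p : G * G) : bool :=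
  (p.1 != p.2) && ~~ adj p.1 p.2.

(* The default value #|G| bounds every term from above, so it only matters when
   G is complete, which [2 <= dom] excludes; see [bpar_attained]
   and [bpar_min]. *)
Definition bpar : nat :=
  \big[minn/#|G|]_(p : G * G | nonadj_pair p) #|nbhd p.1 :&: nbhd p.2|.

End Graph.

Definition isog (G H : sgraph) : Prop :=
  exists2 f : G -> H, bijective f & forall x y, adj (f x) (f y) = adj x y.

Section Step.
Variables (G : sgraph) (clone : pred G).

(* [inl v] is the old vertex v and [inr v] its copy, which is a clone if
   [clone v] holds and an anticlone otherwise. *)
Definition step_adj (x y : G + G) : bool :=
  match x, y with
  | inl u, inl v => adj u v
  | inl u, inr v | inr v, inl u =>
      if clone v then u \in cnbhd v else u \in ~: cnbhd v
  | inr _, inr _ => false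
  end.

Lemma step_adj_sym : symmetric step_adj.
Proof. by case=> [u|u] [v|v] //=; apply: adj_sym. Qed.

Lemma step_adj_irr : irreflexive step_adj.
Proof. by case=> [u|u] //=; apply: adj_irr. Qed.

Lemma step_gt0 : 0 < #|{: G + G}|.
Proof. by rewrite card_sum addn_gt0 vertex_gt0. Qed.

Definition step : sgraph := SGraph step_adj_sym step_adj_irr step_gt0.

End Step.

(* [IIM i G H] means that H belongs to IIM_i(G). The isomorphism allows
   arbitrary names for the added vertices. *)
Inductive IIM (G : sgraph) : nat -> sgraph -> Prop :=
| IIM0 : IIM G 0 G
| IIMS i (H K : sgraph) (clone : pred H) :
    IIM G i H -> isog (step clone) K -> IIM G i.+1 K.

Lemma bigmin_le (I : finType) (P : pred I) (F : I -> nat) n i :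
  P i -> \big[minn/n]_(j | P j) F j <= F i.
Proof.
move=> Pi; rewrite -big_filter.
have: i \in [seq j <- index_enum I | P j] by rewrite mem_filter Pi mem_index_enum.
elim: [seq j <- _ | _] => //= j s IHs; rewrite in_cons big_cons geq_min.
by case/predU1P=> [<-|/IHs ->]; rewrite ?leqnn ?orbT.
Qed.

Lemma bigmin_attained (I : finType) (P : pred I) (F : I -> nat) n i :
  P i -> (forall j, P j -> F j <= n) ->
  exists2 j, P j & F j = \big[minn/n]_(j | P j) F j.
Proof.
move=> Pi Fn; case: (arg_minnP F Pi) => k Pk kmin; exists k => //.
apply/eqP; rewrite eqn_leq (bigmin_le F n Pk) andbT.
apply: (big_ind (leq (F k))) => [|x y kx ky|j]; first exact: Fn.
- by rewrite leq_min kx.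
- exact: kmin.
Qed.

Lemma dom_min (G : sgraph) (D : {set G}) : dominating D -> dom G <= #|D|.
Proof. exact: (bigmin_le (fun D : {set G} => #|D|)). Qed.

Lemma dom_attained (G : sgraph) :
  exists2 D : {set G}, dominating D & #|D| = dom G.
Proof.
apply: (@bigmin_attained _ (@dominating G) (fun D => #|D|) _ setT).
- by apply/forallP => v; rewrite inE.
- by move=> D _; apply: max_card.
Qed.

Lemma bpar_min (G : sgraph) (u v : G) :
  u != v -> ~~ adj u v -> bpar G <= #|nbhd u :&: nbhd v|.
Proof.
move=> uv nuv.
apply: (bigmin_le (fun p : G * G => #|nbhd p.1 :&: nbhd p.2|) _ (i := (u, v))).
by rewrite /nonadj_pair uv.
Qed.

Lemma bpar_attained (G : sgraph) : 2 <= dom G ->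
  exists u v : G,
    [/\ u != v, ~~ adj u v & #|nbhd u :&: nbhd v| = bpar G].
Proof.
move=> dG; have /card_gt0P[x _] := vertex_gt0 G.
have: ~~ dominating [set x].
  by apply/negP => /dom_min; rewrite cards1 leqNgt dG.
case/forallPn => y; rewrite negb_imply inE => /andP[yx /exists_inPn nyx].
have Pyx : nonadj_pair (y, x) by rewrite /nonadj_pair yx nyx ?set11.
have [|[u v] /andP[uv nuv] e] := bigmin_attained
  (F := fun p : G * G => #|nbhd p.1 :&: nbhd p.2|) (n := #|G|) Pyx.
  by move=> p _; apply: max_card.
by exists u, v.
Qed.

(* Main.v *)
(** Call a set [S] splitting if no closed neighborhood is disjoint from [S] or
    contains [S]. A splitting set of a graph still splits the graph after one
    step: a clone meets [S] in the same vertices as the original, and an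
    anticlone meets [S] in the complementary ones. So the size of a splitting
    set of [G] bounds [dom H]. To get one, start from a minimum dominating set
    and add nonadjacent [u], [v] with [bpar G] common neighbors; only these
    common neighbors can now have a closed neighborhood containing the set, and
    adding for each of them a vertex it does not dominate repairs this. *)

Require Import Defs.
From mathcomp Require Import all_boot.

Set Implicit Arguments.
Unset Strict Implicit.
Unset Printing Implicit Defensive.

(** Domination alone is not inherited: if [S] lies inside the closed neighborhood of [v], an
    anticlone of [v] has no neighbor in [S]. The second half excludes this. *)
Definition splitting (G : sgraph) (S : {set G}) : Prop :=
  forall x : G, (exists2 s, s \in S & s \in cnbhd x) /\
                (exists2 s, s \in S & s \notin cnbhd x).

Lemma in_cnbhd (G : sgraph) (x y : G) :
  (y \in cnbhd x) = (y == x) || adj x y.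
Proof. by rewrite !inE. Qed.

Lemma cnbhd_sym (G : sgraph) (x y : G) : (y \in cnbhd x) = (x \in cnbhd y).
Proof. by rewrite !in_cnbhd eq_sym adj_sym. Qed.

Lemma dominatingP (G : sgraph) (D : {set G}) :
  reflect (forall x, exists2 s, s \in D & s \in cnbhd x) (dominating D).
Proof.
apply: (iffP forallP) => [domD x | domD x].
  have [xD|xND] := boolP (x \in D); first by exists x; rewrite // in_cnbhd eqxx.
  have /implyP/(_ xND)/exists_inP[s sD xs] := domD x.
  by exists s; rewrite // in_cnbhd xs orbT.
apply/implyP => xND; have [s sD] := domD x.
rewrite in_cnbhd => /predU1P[sx|xs]; first by rewrite -sx sD in xND.
by apply/exists_inP; exists s.
Qed.

Lemma splitting_dom (G : sgraph) (S : {set G}) : splitting S -> dom G <= #|S|.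
Proof. by move=> splS; apply/dom_min/dominatingP => x; have [] := splS x. Qed.

Lemma splitting_step (G : sgraph) (clone : pred G) (S : {set G}) :
  splitting S -> splitting (inl @: S : {set step clone}).
Proof.
move=> splS x.
(* Only old vertices are tested, so the membership of a copy in its own closed neighborhood never
   matters. *)
have inlE (y : G + G) s : (inl s : step clone) \in cnbhd (y : step clone) =
    match y with
    | inl v => s \in cnbhd v
    | inr v => (s \in cnbhd v) == clone v
    end.
  rewrite in_cnbhd; case: y => v /=; first by rewrite in_cnbhd.
  by case: (clone v); rewrite ?eqb_id ?eqbF_neg ?in_setC.
case: x => v; have [[s sS sv] [t tS tv]] := splS v.
  by split; [exists (inl s) | exists (inl t)]; rewrite ?imset_f ?inlE.
case cv: (clone v); split.
- by exists (inl s); rewrite ?imset_f ?inlE ?sv ?cv.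
- by exists (inl t); rewrite ?imset_f ?inlE ?(negbTE tv) ?cv.
(* For an anticlone the two witnesses trade roles. *)
- by exists (inl t); rewrite ?imset_f ?inlE ?(negbTE tv) ?cv.
- by exists (inl s); rewrite ?imset_f ?inlE ?sv ?cv.
Qed.

(** Needed because [IIM] takes each step up to isomorphism. *)
Lemma splitting_isog (G H : sgraph) (S : {set G}) :
  isog G H -> splitting S -> exists2 T : {set H}, #|T| = #|S| & splitting T.
Proof.
case=> f bij_f adj_f splS; have inj_f := bij_inj bij_f.
have cnbhd_f x y : (f y \in cnbhd (f x)) = (y \in cnbhd x).
  by rewrite !in_cnbhd adj_f inj_eq.
exists (f @: S) => [|y]; first exact: card_imset.
have [g _ gK] := bij_f; rewrite -(gK y).
have [[s sS sy] [t tS ty]] := splS (g y).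
by split; [exists (f s) | exists (f t)]; rewrite ?imset_f ?cnbhd_f.
Qed.

Lemma splitting_IIM (G : sgraph) (S : {set G}) i (H : sgraph) :
  splitting S -> IIM G i H ->
  exists2 T : {set H}, #|T| = #|S| & splitting T.
Proof.
move=> splS; elim=> [|{}i {}H K clone _ [T <- splT] HK]; first by exists S.
have [U cU splU] := splitting_isog HK (splitting_step splT).
by exists U; rewrite // cU card_imset //; apply: inl_inj.
Qed.

(** Otherwise [[set x]] would be dominating. *)
Lemma exists_notin_cnbhd (G : sgraph) (x : G) :
  2 <= dom G -> exists y, y \notin cnbhd x.
Proof.
move=> dG; apply/existsP; apply: contraTT dG; rewrite negb_exists.
move=> /forallP cx; rewrite -ltnNge -(cards1 x) ltnS; apply: dom_min.
apply/dominatingP => y; exists x; first exact: set11.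
by rewrite cnbhd_sym; have := cx y; rewrite negbK.
Qed.

Lemma exists_splitting (G : sgraph) : 2 <= dom G ->
  exists2 S : {set G}, #|S| <= dom G + bpar G + 2 & splitting S.
Proof.
move=> dG; have [D /dominatingP domD <-] := dom_attained G.
have [u [v [uv nuv <-]]] := bpar_attained dG.
pose far x := xchoose (exists_notin_cnbhd x dG).
set W := nbhd u :&: nbhd v.
exists (D :|: far @: W :|: [set u; v]) => [|x].
  rewrite (leq_trans (leq_card_setU _ _)) // cards2 uv leq_add2r.
  by rewrite (leq_trans (leq_card_setU _ _)) // leq_add2l leq_imset_card.
split; first by have [s sD sx] := domD x; exists s; rewrite // !inE sD.
have [ux|] := boolP (u \in cnbhd x); last by exists u; rewrite // !inE eqxx !orbT.
have [vx|] := boolP (v \in cnbhd x); last by exists v; rewrite // !inE eqxx !orbT.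
(* Since [u] and [v] are distinct and nonadjacent, [x] can be neither of them, so it is adjacent to
   both. *)
have xW : x \in W.
  move: ux vx; rewrite cnbhd_sym (cnbhd_sym x v) !inE.
  have [->|_] := eqVneq x u; first by rewrite (negbTE uv) adj_sym (negbTE nuv).
  by have [->|_] := eqVneq x v; rewrite ?(negbTE nuv) //= => -> ->.
exists (far x); first by rewrite !in_setU imset_f ?orbT.
exact: xchooseP (exists_notin_cnbhd x dG).
Qed.

Theorem theorem4p5 (G : sgraph) (hG : 2 <= dom G) (i : nat) (H : sgraph)
    (hH : IIM G i H) :
  dom H <= dom G + bpar G + 3.
Proof.
have [S leS splS] := exists_splitting hG.
have [T cT splT] := splitting_IIM splS hH.
apply: leq_trans (splitting_dom splT) _; rewrite cT.
(* The construction gives the constant 2, so [2 <= 3] is all that remains. *)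
by apply: leq_trans leS _; rewrite leq_add2l.
Qed.
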